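(* Let $X=\mathbb{R}^n$, $Y=\mathbb{R}^m$, $S=X\times Y$, $\mu^*\in P(S)$, $\varepsilon\ge0$, and let $\mathcal{G}=\mathrm{Lip}(Y;X)$ be the set of Lipschitz maps $G:Y\to X$, with $L_G$ denoting the Lipschitz constant of $G$. Let $\ell(x,y,G):=\|G(y)-x\|_2^2$ and $c((x,y),(u,v)):=\|(u,v)-(x,y)\|_2^2$, and take $K_s=P(S)$ for every $s\in S$. Then $$\inf_{G\in\mathcal{G}}I_{\Omega_{K,c,\varepsilon}}(G)\ \le\ \inf_{G\in\mathcal{G}}\left(\sqrt{\int_S\|G(y)-x\|_2^2\,d\mu^*(x,y)}+\sqrt{\varepsilon(1+L_G^2)}\right)^2.$$
   Context: $P(S)$ is the set of Borel probability measures on $S$, and $\|\cdot\|_2$ is the Euclidean norm. The notation $\pi_{S|S}:S\to K_s$ means a $\mu^*$-measurable kernel $s\mapsto\pi_{S|S=s}\in P(S)$ such that $\pi_{S|S=s}\in K_s$ for $\mu^*$-a.e. $s\in S$. Define $$\Omega_{K,c,\varepsilon}:=\Big\{\pi_{S|S}:S\to K_s\ :\ \int_S\int_S c(s,r)\,d\pi_{S|S=s}(r)\,d\mu^*(s)\le\varepsilon\Big\},$$ $$I_{\Omega_{K,c,\varepsilon}}(G):=\sup_{\pi_{S|S}\in\Omega_{K,c,\varepsilon}}\int_S\int_S\ell(r,G)\,d\pi_{S|S=s}(r)\,d\mu^*(s).$$ *)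

(* Defs.v *)
From HB Require Import structures.
From mathcomp Require Import all_boot all_order all_algebra.
From mathcomp Require Import all_classical all_reals all_analysis.
Set Implicit Arguments.
Unset Strict Implicit.
Unset Printing Implicit Defensive.
Import Order.TTheory GRing.Theory Num.Theory.
Import numFieldNormedType.Exports.
Local Open Scope classical_set_scope.
Local Open Scope ring_scope.

Definition enorm (R : realType) (n : nat) (v : 'rV[R]_n) : R :=
  Num.sqrt (\sum_(i < n) v ord0 i ^+ 2).

(* The Borel sigma-algebra of R^n x R^m: the matrix and product topologies of
   the library come from max norms, but these have the same open sets as the
   Euclidean norm. *)
Definition borelXY (R : realType) (n m : nat) : measurableType _ :=
  g_sigma_algebraType (@open ('rV[R]_n * 'rV[R]_m)%type).

(* `completion mu` is the carrier S with the Caratheodory sigma-algebra of the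
   outer measure induced by mu; as mu is finite, this is the completion of the
   sigma-algebra of S by mu, i.e., the sigma-algebra of mu-measurable sets.
   `completed mu` is the extension of mu to it. *)
Section completion.
Context d (S : measurableType d) (R : realType).

Definition completion (mu : probability S R) := caratheodory_type (mu^*)%mu.

Definition completed (mu : probability S R) : {measure set _ -> \bar R} :=
  @completed_measure_extension d S R mu.

End completion.

Section ambiguity.
Context d (S : measurableType d) (R : realType).
Local Open Scope ereal_scope.

Section pker_prob.
Context d' (T : measurableType d') (pi : R.-pker T ~> S) (s : T).

(* Kernel values in the library are only measures; this recasts them in P(S). *)
Definition pker_prob : set S -> \bar R := pi s.

HB.instance Definition _ := Measure.on pker_prob.
HB.instance Definition _ :=
  Measure_isProbability.Build _ _ _ pker_prob (prob_kernel s).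

End pker_prob.

Definition Omega (mu : probability S R) (K : S -> set (probability S R))
    (c : S -> S -> R) (eps : R) : set (R.-pker (completion mu) ~> S) :=
  [set pi : R.-pker (completion mu) ~> S |
    (\forall s \ae mu, K s (pker_prob pi s)) /\
    \int[completed mu]_s \int[pi s]_r (c s r)%:E <= eps%:E].

Definition I_Omega (mu : probability S R) (K : S -> set (probability S R))
    (c : S -> S -> R) (eps : R) (H : Type) (l : S -> H -> R) (G : H) : \bar R :=
  ereal_sup [set \int[completed mu]_s \int[pi s]_r (l r G)%:E
            | pi in @Omega mu K c eps].

End ambiguity.

Section lipschitz.
Context (R : realType) (n m : nat).
Implicit Types G : 'rV[R]_m -> 'rV[R]_n.

(* Lipschitz bounds for the Euclidean norms; the library's `k.-lipschitz`
   refers to the max norms. *)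
Definition lip_bounds G : set R :=
  [set k | 0 <= k /\ forall y y', enorm (G y - G y') <= k * enorm (y - y')].

Definition Lip : set ('rV[R]_m -> 'rV[R]_n) := [set G | lip_bounds G !=set0].

Definition lip_const G : R := inf (lip_bounds G).

End lipschitz.
Arguments Lip : clear implicits.

Section cost_loss.
Context (R : realType) (n m : nat).
Local Notation S := ('rV[R]_n * 'rV[R]_m)%type.

Definition cost (s r : S) : R :=
  enorm (row_mx r.1 r.2 - row_mx s.1 s.2) ^+ 2.

Definition loss (s : S) (G : 'rV[R]_m -> 'rV[R]_n) : R :=
  enorm (G s.2 - s.1) ^+ 2.

End cost_loss.

(* Main.v *)
(** Young's inequality [|u + v|^2 <= (1 + t) |u|^2 + (1 + 1/t) |v|^2] gives,
    for [s = (x, y)] and [r = (u, v)],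
    [loss r G <= (1 + t) loss s G + (1 + 1/t) (1 + L_G^2) cost s r].
    Integrating first against [pi s] and then against [mu] bounds the worst-case
    risk by [(1 + t) A + (1 + 1/t) (1 + L_G^2) eps] for every [t > 0], where [A]
    is the nominal risk; minimising over [t] yields the square of the sum of the
    square roots. *)
Require Import Defs.
From HB Require Import structures.
From mathcomp Require Import all_boot all_order all_algebra.
From mathcomp Require Import all_classical all_reals all_analysis.
From mathcomp Require Import measurable_realfun ring lra.
Set Implicit Arguments.
Unset Strict Implicit.
Unset Printing Implicit Defensive.
Import Order.TTheory GRing.Theory Num.Theory.
Import numFieldNormedType.Exports.
Local Open Scope classical_set_scope.
Local Open Scope ereal_scope.

(** * Euclidean norm: Young's inequality and continuity *)

Section euclidean_norm.
Local Open Scope ring_scope.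
Context {R : realType}.

Lemma sqr_enorm k (v : 'rV[R]_k) : enorm v ^+ 2 = \sum_(i < k) v ord0 i ^+ 2.
Proof. by rewrite sqr_sqrtr// sumr_ge0// => i _; rewrite sqr_ge0. Qed.

Lemma enorm_ge0 k (v : 'rV[R]_k) : 0 <= enorm v.
Proof. exact: sqrtr_ge0. Qed.

Lemma enormN k (v : 'rV[R]_k) : enorm (- v) = enorm v.
Proof. by congr Num.sqrt; apply: eq_bigr => i _; rewrite mxE sqrrN. Qed.

Lemma norm_coord_le_enorm k (v : 'rV[R]_k) i : `|v ord0 i| <= enorm v.
Proof.
rewrite -sqrtr_sqr ler_wsqrtr// (bigD1 i)//= lerDl sumr_ge0// => j _.
exact: sqr_ge0.
Qed.

Lemma enorm_eq0 k (v : 'rV[R]_k) : enorm v = 0 -> v = 0.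
Proof.
move=> v0; apply/rowP => i; rewrite mxE; apply/eqP.
by rewrite -normr_le0 -v0 norm_coord_le_enorm.
Qed.

(** In each coordinate, the right side minus the left is the square [t^-1 * (t * a - b) ^+ 2]. *)
Lemma sqr_enormD_le k (u v : 'rV[R]_k) (t : R) : 0 < t ->
  enorm (u + v) ^+ 2 <= (1 + t) * enorm u ^+ 2 + (1 + t^-1) * enorm v ^+ 2.
Proof.
move=> t0; rewrite !sqr_enorm !mulr_sumr -big_split/=; apply: ler_sum => i _.
rewrite mxE; set a := u _ _; set b := v _ _; rewrite -subr_ge0.
have -> : (1 + t) * a ^+ 2 + (1 + t^-1) * b ^+ 2 - (a + b) ^+ 2 =
    t^-1 * (t * a - b) ^+ 2 by field; rewrite gt_eqF.
by rewrite mulr_ge0 ?sqr_ge0// invr_ge0 ltW.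
Qed.

Lemma enorm_continuous k : continuous (@enorm R k).
Proof.
move=> v; apply: (@continuous_comp _ _ _ _ Num.sqrt); last exact: sqrt_continuous.
apply: (cvg_big (@add_continuous R^o) (F := nbhs v)
  (Ff := fun i (w : 'rV[R]_k) => w ord0 i ^+ 2)) => i _.
by apply: cvgM; exact: coord_continuous.
Qed.

End euclidean_norm.

(** * Lipschitz maps and the pointwise bound on the loss *)

Section lipschitz_maps.
Local Open Scope ring_scope.
Context {R : realType} {n m : nat}.
Variable G : 'rV[R]_m -> 'rV[R]_n.
Hypothesis lipG : Lip R n m G.

Lemma lip_const_ge0 : 0 <= lip_const G.
Proof. by apply: lb_le_inf => // k []. Qed.

Lemma lip_constP y y' : enorm (G y - G y') <= lip_const G * enorm (y - y').
Proof.
(* Off the diagonal, every Lipschitz bound dominates the difference quotient, hence so does their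
   infimum. At distance zero there is no quotient, and any single bound settles the claim. *)
have [d0|d_neq0] := eqVneq (enorm (y - y')) 0.
  by have [k [_ /(_ y y')]] := lipG; rewrite d0 !mulr0.
have d_gt0 : 0 < enorm (y - y') by rewrite lt_def d_neq0 enorm_ge0.
rewrite -ler_pdivrMr//; apply: lb_le_inf => // k [_ kG].
by rewrite ler_pdivrMr.
Qed.

(** The increment is at most [lip_const G * enorm (y - z)], and [enorm] is continuous for the
    max-norm topology, so the two norms need not be compared. *)
Lemma lip_coord_continuous i : continuous (fun y => G y ord0 i).
Proof.
move=> y; apply/(@cvgrPdist_le _ _ _ (nbhs y)) => /= e e0.
have cvg0 : lip_const G * enorm (y - z) @[z --> y] --> (0 : R).
  rewrite -[X in _ --> X](mulr0 (lip_const G)).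
  apply: (cvgMl_tmp (F := nbhs (y : 'rV[R]_m))).
  have <- : enorm (y - y) = 0.
    by rewrite subrr /enorm big1 ?sqrtr0// => j _; rewrite mxE expr0n.
  apply: (@continuous_comp _ _ _ (fun z : 'rV[R]_m => y - z) (@enorm R m));
    last exact: enorm_continuous.
  by apply: (@cvgB _ 'rV[R]_m _ (nbhs (y : 'rV[R]_m)) _ (fun=> y) id);
    [exact: cvg_cst | exact: cvg_id].
have /cvgrPdist_le/(_ _ e0) := cvg0; apply: filterS => z; rewrite sub0r normrN.
rewrite ger0_norm ?mulr_ge0 ?lip_const_ge0 ?enorm_ge0//; apply: le_trans.
apply: le_trans (lip_constP y z).
by have := norm_coord_le_enorm (G y - G z) i; rewrite !mxE.
Qed.

Lemma sqr_cost (s r : 'rV[R]_n * 'rV[R]_m) :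
  cost s r = enorm (r.1 - s.1) ^+ 2 + enorm (r.2 - s.2) ^+ 2.
Proof.
rewrite /cost opp_row_mx add_row_mx !sqr_enorm big_split_ord/=.
by congr +%R; apply: eq_bigr => i _; rewrite (row_mxEl, row_mxEr).
Qed.

(** Write L for [lip_const G]. Young's inequality with parameter L^-2 gives [p] the coefficient 1 +
    L^-2 and [q] the coefficient 1 + L^2; since |p|^2 <= L^2 |d|^2, both [d] and [q] end up with 1 +
    L^2. *)
Lemma loss_increment_le (s r : 'rV[R]_n * 'rV[R]_m) :
  enorm ((G r.2 - r.1) - (G s.2 - s.1)) ^+ 2 <= (1 + lip_const G ^+ 2) * cost s r.
Proof.
have -> : (G r.2 - r.1) - (G s.2 - s.1) = (G r.2 - G s.2) + - (r.1 - s.1).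
  by apply/rowP => i; rewrite !mxE; ring.
rewrite sqr_cost; set p := G _ - _; set q := r.1 - _; set d := r.2 - _.
have : enorm p ^+ 2 <= lip_const G ^+ 2 * enorm d ^+ 2.
  by rewrite -exprMn ler_sqr ?nnegrE ?mulr_ge0 ?enorm_ge0 ?lip_const_ge0// lip_constP.
(* For L = 0 the parameter L^-2 is not positive, but then [p] vanishes. *)
have := lip_const_ge0; rewrite le_eqVlt => /predU1P[<-|L0 pd].
  rewrite expr0n/= mul0r => p_le0.
  have /enorm_eq0-> : enorm p = 0.
    by apply/eqP; rewrite -sqrf_eq0 eq_le p_le0 sqr_ge0.
  by rewrite add0r enormN addr0 mul1r lerDl sqr_ge0.
have L2 : 0 < lip_const G ^- 2 by rewrite invr_gt0 exprn_gt0.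
apply: (le_trans (sqr_enormD_le p (- q) L2)).
rewrite invrK enormN mulrDr [leRHS]addrC lerD2r.
apply: (@le_trans _ _ ((1 + lip_const G ^- 2) * (lip_const G ^+ 2 * enorm d ^+ 2))).
  by rewrite ler_wpM2l// addr_ge0// ltW.
by rewrite mulrA mulrDl mul1r mulVf ?gt_eqF ?exprn_gt0// addrC.
Qed.

Lemma loss_le (s r : 'rV[R]_n * 'rV[R]_m) (t : R) : 0 < t ->
  loss r G <= (1 + t) * loss s G + (1 + t^-1) * (1 + lip_const G ^+ 2) * cost s r.
Proof.
move=> t0; rewrite /loss -[in leLHS](subrKC (G s.2 - s.1) (G r.2 - r.1)).
apply: (le_trans (sqr_enormD_le _ _ t0)); rewrite lerD2l -mulrA ler_wpM2l//.
  by rewrite addr_ge0// invr_ge0 ltW.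
exact: loss_increment_le.
Qed.

End lipschitz_maps.

(** * Measurability of the loss and integration against kernels *)

Lemma continuous_borelXY_measurable (R : realType) n m
    (f : 'rV[R]_n * 'rV[R]_m -> R) : continuous f ->
  measurable_fun [set: borelXY R n m] f.
Proof.
move=> /continuousP cf; apply: (measurability _ (RGenOpens.measurableE R)).
move=> _ [_ [a [b ->] <-]]; rewrite setTI; apply: sub_sigma_algebra.
exact/cf/interval_open.
Qed.

Lemma fst_coord_continuous (R : realType) n m i :
  continuous (fun s : 'rV[R]_n * 'rV[R]_m => s.1 ord0 i).
Proof.
move=> s; apply: (@continuous_comp _ _ _ fst (fun x : 'rV[R]_n => x ord0 i)).
  exact: cvg_fst.
exact: coord_continuous.
Qed.

Lemma snd_coord_continuous (R : realType) n m i :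
  continuous (fun s : 'rV[R]_n * 'rV[R]_m => s.2 ord0 i).
Proof.
move=> s; apply: (@continuous_comp _ _ _ snd (fun x : 'rV[R]_m => x ord0 i)).
  exact: cvg_snd.
exact: coord_continuous.
Qed.

Lemma measurable_loss (R : realType) n m (G : 'rV[R]_m -> 'rV[R]_n) :
  Lip R n m G -> measurable_fun [set: borelXY R n m] (fun s => loss s G).
Proof.
move=> lipG; apply: continuous_borelXY_measurable => s.
have -> : (fun s => loss s G) = fun s : 'rV[R]_n * 'rV[R]_m =>
    (\sum_(i < n) (G s.2 ord0 i - s.1 ord0 i) ^+ 2)%R.
  by apply/funext => r; rewrite /loss sqr_enorm; apply: eq_bigr => i _; rewrite !mxE.
apply: (cvg_big (@add_continuous R^o) (F := nbhs s)
  (Ff := fun i (w : 'rV[R]_n * 'rV[R]_m) =>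
    ((G w.2 ord0 i - w.1 ord0 i) ^+ 2)%R)) => i _.
have cvgi : (fun r : 'rV[R]_n * 'rV[R]_m => G r.2 ord0 i - r.1 ord0 i)%R @ s
    --> (G s.2 ord0 i - s.1 ord0 i)%R.
  apply: cvgB; last exact: fst_coord_continuous.
  apply: (@continuous_comp _ _ _ snd (fun y => G y ord0 i)); first exact: cvg_snd.
  exact: lip_coord_continuous.
by apply: cvgM.
Qed.

(** [f] and [g] are kept apart because both will be the loss, once on the completion and once on the
    Borel space. *)
Lemma integral_kernel_le d d' (T : measurableType d) (S : measurableType d')
    (R : realType) (nu : ({measure set T -> \bar R})%R) (pi : R.-pker T ~> S)
    (f : T -> R) (g : S -> R) (c : T -> S -> R) (a b : R) :
  (0 <= a)%R -> (0 <= b)%R -> (forall s, 0 <= f s)%R ->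
  (forall r, 0 <= g r)%R -> (forall s r, 0 <= c s r)%R ->
  measurable_fun setT f -> measurable_fun setT g ->
  measurable_fun [set: T * S] (fun z => c z.1 z.2) ->
  (forall s r, g r <= a * f s + b * c s r)%R ->
  \int[nu]_s \int[pi s]_r (g r)%:E <=
  a%:E * \int[nu]_s (f s)%:E + b%:E * \int[nu]_s \int[pi s]_r (c s r)%:E.
Proof.
move=> a0 b0 f0 g0 c0 mf mg mc gfc.
have mfE : measurable_fun setT (fun s => (f s)%:E) by exact/measurable_EFinP.
have mgE : measurable_fun setT (fun r => (g r)%:E) by exact/measurable_EFinP.
have mcs s : measurable_fun [set: S] (fun r => (c s r)%:E).
  by apply/measurable_EFinP; exact: (measurableT_comp mc (pair1_measurable s)).
have mintc : measurable_fun [set: T] (fun s => \int[pi s]_r (c s r)%:E).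
  apply: (measurable_fun_integral_finite_kernel
    (fun z : T * S => (c z.1 z.2)%:E) pi).
    by move=> z; rewrite lee_fin.
  exact/measurable_EFinP.
have mintg : measurable_fun [set: T] (fun s => \int[pi s]_r (g r)%:E).
  exact: (measurable_fun_integral_kernel (measurable_kernel pi)).
have intc0 s : 0 <= \int[pi s]_r (c s r)%:E.
  by apply: integral_ge0 => r _; rewrite lee_fin.
rewrite -ge0_integralZl_EFin//; last by move=> s _; rewrite lee_fin.
rewrite -ge0_integralZl_EFin//.
rewrite -ge0_integralD//; first last.
- exact: measurable_funeM.
- by move=> s _; rewrite mule_ge0.
- exact: measurable_funeM.
- by move=> s _; rewrite mule_ge0 ?lee_fin.
apply: ge0_le_integral => //.
- by move=> s _; apply: integral_ge0 => r _; rewrite lee_fin.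
- by apply: emeasurable_funD; exact: measurable_funeM.
move=> s _.
rewrite -ge0_integralZl_EFin//; last by move=> r _; rewrite lee_fin.
(* [pi s] has mass one, so the term constant in [r] can be moved under the inner integral. *)
have -> : a%:E * (f s)%:E = \int[pi s]_r (a * f s)%:E.
  by rewrite integral_cst// prob_kernel mule1 EFinM.
rewrite -ge0_integralD//.
- apply: ge0_le_integral => //.
  + by move=> r _; rewrite lee_fin.
  + by apply: emeasurable_funD => //; exact: measurable_funeM.
  + by move=> r _; rewrite -EFinM -EFinD lee_fin.
- by move=> r _; rewrite lee_fin mulr_ge0.
- by move=> r _; rewrite -EFinM lee_fin mulr_ge0.
- exact: measurable_funeM.
Qed.

(** * Passing between a measure and its completion *)

Section completion_integrals.
Context d (S : measurableType d) (R : realType) (mu : probability S R).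

Lemma measurable_completion_id :
  measurable_fun [set: completion mu] (id : completion mu -> S).
Proof.
by move=> _ A mA; rewrite setTI; exact: caratheodory_measurable_mu_ext.
Qed.

(** Change of variables along the identity: the pushforward of [completed mu] agrees with [mu] on
    the measurable sets of [S]. *)
Lemma integral_completed (f : S -> \bar R) :
  measurable_fun setT f -> (forall s, 0 <= f s) ->
  \int[completed mu]_s f s = \int[mu]_s f s.
Proof.
move=> mf f0.
rewrite -[LHS](@ge0_integral_pushforward _ _ _ _ _ _ measurable_completion_id
  _ setT f)//.
apply: eq_measure_integral; first exact: measurable_completion_id.
by move=> mid A mA _; exact: measurable_mu_extE.
Qed.

End completion_integrals.

Lemma measurable_cost (R : realType) n m d (T : measurableType d)
    (phi : T -> borelXY R n m) : measurable_fun setT phi ->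
  measurable_fun [set: T * borelXY R n m] (fun z => cost (phi z.1) z.2).
Proof.
move=> mphi.
have msqr (f : 'rV[R]_n * 'rV[R]_m -> R) : continuous f ->
    measurable_fun [set: T * borelXY R n m]
      (fun z => (f z.2 - f (phi z.1)) ^+ 2)%R.
  move=> /continuous_borelXY_measurable mf; apply: measurable_funX.
  apply: measurable_funB; first exact: (measurableT_comp mf measurable_snd).
  exact: (measurableT_comp mf (measurableT_comp mphi measurable_fst)).
(* [T] carries no topology, so continuity of the cost is of no help; each coordinate is measurable
   on its own factor. *)
have -> : (fun z : T * borelXY R n m => cost (phi z.1) z.2) = fun z =>
    (\sum_(i < n) (z.2.1 ord0 i - (phi z.1).1 ord0 i) ^+ 2 +
     \sum_(j < m) (z.2.2 ord0 j - (phi z.1).2 ord0 j) ^+ 2)%R.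
  apply/funext => z; rewrite sqr_cost !sqr_enorm.
  by congr +%R; apply: eq_bigr => i _; rewrite !mxE.
apply: measurable_funD; apply: measurable_sum => i.
- by apply: (msqr (fun s => s.1 ord0 i)); exact: fst_coord_continuous.
- by apply: (msqr (fun s => s.2 ord0 i)); exact: snd_coord_continuous.
Qed.

(* The choice [t = q / p] is optimal when [p = sqrt A] and [q = sqrt B] are
   positive; a small shift of both covers the degenerate cases. *)
Lemma le_sqr_sqrtD (R : realType) (x : \bar R) (A B : R) :
  (0 <= A)%R -> (0 <= B)%R ->
  (forall t : R, (0 < t)%R -> x <= ((1 + t) * A + (1 + t^-1) * B)%:E) ->
  x <= ((Num.sqrt A + Num.sqrt B) ^+ 2)%:E.
Proof.
move=> A0 B0 xAB.
have shift (e : R) : (0 < e)%R ->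
    x <= ((Num.sqrt A + Num.sqrt B + e *+ 2) ^+ 2)%:E.
  move=> e0; set p := (Num.sqrt A + e)%R; set q := (Num.sqrt B + e)%R.
  have p0 : (0 < p)%R by rewrite ltr_wpDl ?sqrtr_ge0.
  have q0 : (0 < q)%R by rewrite ltr_wpDl ?sqrtr_ge0.
  apply: (le_trans (xAB _ (divr_gt0 q0 p0))); rewrite lee_fin.
  have -> : ((Num.sqrt A + Num.sqrt B + e *+ 2) ^+ 2 =
      (1 + q / p) * p ^+ 2 + (1 + (q / p)^-1) * q ^+ 2)%R.
    rewrite (_ : Num.sqrt A + Num.sqrt B + e *+ 2 = p + q)%R; last first.
      by rewrite /p /q; ring.
    by field; rewrite !gt_eqF.
  have sqr_shift (C : R) : (0 <= C -> C <= (Num.sqrt C + e) ^+ 2)%R.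
    move=> C0; rewrite -[leLHS]sqr_sqrtr// ler_sqr ?nnegrE ?sqrtr_ge0//.
      by rewrite lerDl ltW.
    by rewrite addr_ge0 ?sqrtr_ge0 ?ltW.
  by apply: lerD; apply: ler_wpM2l; rewrite ?sqr_shift// addr_ge0// ?invr_ge0 ltW// divr_gt0.
(* The value +oo is excluded by the hypothesis at t = 1. *)
case: x xAB shift => [x|/(_ 1%R ltr01)//|]; last by rewrite leNye.
move=> _ shift; rewrite lee_fin leNgt; apply/negP => sx.
set s := (Num.sqrt A + Num.sqrt B)%R in shift sx.
have s0 : (0 <= s)%R by rewrite addr_ge0 ?sqrtr_ge0.
have x0 : (0 <= x)%R by rewrite (le_trans _ (ltW sx)) ?sqr_ge0.
have sqx := sqr_sqrtr x0; have q0 := sqrtr_ge0 x.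
move: sx shift; rewrite -sqx; set q := Num.sqrt x in q0 *.
rewrite ltr_sqr ?nnegrE// => sq.
(* With this shift, [s + e *+ 2] is the midpoint of [s] and [q], which is still below [q]. *)
have /[swap] /[apply] : (0 < (q - s) / 4)%R by lra.
rewrite lee_fin ler_sqr ?nnegrE//; lra.
Qed.

Lemma I_Omega_le (R : realType) (n m : nat)
    (mu : probability (borelXY R n m) R) (eps : R) (eps_ge0 : (0 <= eps)%R)
    (G : 'rV[R]_m -> 'rV[R]_n) : Lip R n m G ->
  I_Omega mu (fun=> setT) (@cost R n m) eps (@loss R n m) G <=
  (sqrte (\int[mu]_s (loss s G)%:E)
   + (Num.sqrt (eps * (1 + lip_const G ^+ 2)))%:E) ^+ 2.
Proof.
move=> lipG; apply: ge_ereal_sup => _ [pi [_ pi_eps] <-].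
have loss0 s : (0 <= loss s G)%R by exact: sqr_ge0.
have L0 : (0 <= 1 + lip_const G ^+ 2)%R by rewrite addr_ge0// sqr_ge0.
have step (t : R) : (0 < t)%R ->
    \int[completed mu]_s \int[pi s]_r (loss r G)%:E <=
    (1 + t)%:E * \int[mu]_s (loss s G)%:E +
    ((1 + t^-1) * (eps * (1 + lip_const G ^+ 2)))%:E.
  move=> t0; have t1 : (0 <= 1 + t^-1)%R by rewrite addr_ge0// invr_ge0 ltW.
  have b0 := mulr_ge0 t1 L0.
  have mloss := measurable_loss lipG.
  have mloss' : measurable_fun [set: completion mu] (fun s => loss s G).
    exact: (measurableT_comp mloss (@measurable_completion_id _ _ _ mu)).
  have mcost : measurable_fun [set: completion mu * borelXY R n m]
      (fun z => cost z.1 z.2).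
    exact: (measurable_cost (@measurable_completion_id _ _ _ mu)).
  have a0 : (0 <= 1 + t)%R by rewrite addr_ge0// ltW.
  have cost0 (s r : 'rV[R]_n * 'rV[R]_m) : (0 <= cost s r)%R by exact: sqr_ge0.
  apply: (le_trans (integral_kernel_le (completed mu) pi a0 b0 loss0 loss0 cost0
    mloss' mloss mcost (fun s r => loss_le lipG s r t0))).
  rewrite integral_completed//; last exact/measurable_EFinP.
  rewrite leeD2l// [(eps * _)%R]mulrC mulrA [leRHS]EFinM.
  by rewrite lee_wpmul2l// lee_fin.
have : 0 <= \int[mu]_s (loss s G)%:E.
  by apply: integral_ge0 => s _; rewrite lee_fin.
(* An infinite nominal risk makes the right side +oo; a finite one allows the optimisation over
   [t]. *)
case: (\int[mu]_s _) step => [A step A0|_ _|_]//; last first.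
  by rewrite [sqrte _]/= addye// expe2 mulyy leey.
rewrite [sqrte _]/= -EFinD -EFin_expe; apply: le_sqr_sqrtD => //.
by rewrite mulr_ge0.
Qed.

Theorem theorem4p1 (R : realType) (n m : nat)
    (mu : probability (borelXY R n m) R) (eps : R) (eps_ge0 : (0 <= eps)%R) :
  ereal_inf [set I_Omega mu (fun=> setT) (@cost R n m) eps
                   (@loss R n m) G | G in Lip R n m]
  <= ereal_inf [set (sqrte (\int[mu]_s (loss s G)%:E)
                     + (Num.sqrt (eps * (1 + lip_const G ^+ 2)))%:E) ^+ 2
               | G in Lip R n m].
Proof.
apply/le_ereal_inf_tmp => _ [G lipG <-].
apply: (le_trans _ (I_Omega_le _ _ _)) => //.
by apply: ereal_inf_lbound; exists G.
Qed.
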